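(* Let $\mathcal{A}=(\mathbf{A}_1,\mathbf{A})$ be a quantum space and let $\psi,\varphi\in\mathfrak{Z}^2[\mathbf{A}_1]$ be counital 2-cocycles, with $\psi$ admissible for $\mathcal{A}$ and $\varphi$ admissible for $\mathcal{A}_\psi$. Then $\psi\star\varphi$ is $\mathcal{A}$-admissible and $(\mathcal{A}_\psi)_\varphi=\mathcal{A}_{\psi\star\varphi}$. In addition $\mathfrak{i}\psi$, the inverse of $\psi$ under the product $\star$, is admissible for $\mathcal{A}_\psi$, and accordingly $(\mathcal{A}_\psi)_{\mathfrak{i}\psi}=\mathcal{A}$.
   Context: $\Bbbk$ is $\mathbb{R}$ or $\mathbb{C}$. A quantum space is a pair $\mathcal{A}=(\mathbf{A}_1,\mathbf{A})$ with $\mathbf{A}$ a unital associative $\Bbbk$-algebra generated by a finite-dimensional subspace $\mathbf{A}_1$; $\Pi:\mathbf{A}_1^\otimes\twoheadrightarrow\mathbf{A}$ is the canonical epimorphism from the tensor algebra (the algebra map restricting to the inclusion of $\mathbf{A}_1$). For a vector space $\mathbf{V}$, $\mathsf{C}^1[\mathbf{V}]$ (resp. $\mathsf{C}^2[\mathbf{V}]$) is the group of linear automorphisms of $\mathbf{V}^\otimes$ (resp. $\mathbf{V}^\otimes\otimes\mathbf{V}^\otimes$) preserving each $\mathbf{V}^{\otimes r}$ (resp. each $\mathbf{V}^{\otimes r}\otimes\mathbf{V}^{\otimes s}$); subscripts denote restrictions. Identifying $\mathbf{V}^{\otimes r}\otimes\mathbf{V}^{\otimes s}\cong\mathbf{V}^{\otimes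 r+s}$ by multiplication: for $\theta\in\mathsf{C}^1[\mathbf{V}]$, $\partial\theta\in\mathsf{C}^2[\mathbf{V}]$ is given by $(\partial\theta)_{r,s}=\theta_{r+s}(\theta_r\otimes\theta_s)^{-1}$; $\psi\in\mathsf{C}^2[\mathbf{V}]$ is a 2-cocycle if $\psi_{r+s,t}(\psi_{r,s}\otimes id_t)=\psi_{r,s+t}(id_r\otimes\psi_{s,t})$ for all $r,s,t$. It is counital if $\psi(1\otimes a)=1\otimes a$, $\psi(a\otimes1)=a\otimes1$. $\mathfrak{Z}^2[\mathbf{V}]$ is the set of counital 2-cocycles. Every $\psi\in\mathfrak{Z}^2[\mathbf{V}]$ has a unique primitive: $\theta\in\mathsf{C}^1[\mathbf{V}]$ with $\theta_0=id$, $\theta_1=id$ and $\psi=\partial\theta$. The set $\mathfrak{Z}^2[\mathbf{V}]$ is a group under $\psi\star\varphi=\psi\,(\theta\otimes\theta)\,\varphi\,(\theta\otimes\theta)^{-1}$, $\theta$ the primitive of $\psi$; unit is the identity map, inverse $\mathfrak{i}\psi=\partial(\theta^{-1})$. $\psi\in\mathsf{C}^2[\mathbf{A}_1]$ is $\mathcal{A}$-admissible if $\psi(\ker\Pi^{\otimes2})=\ker\Pi^{\otimes2}$; for such $\psi\in\mathfrak{Z}^2[\mathbf{A}_1]$ the twisting is the quantum space $\mathcal{A}_\psi=(\mathbf{A}_1,\mathbf{A}_\psi)$, with $\mathbf{A}_\psi$ the vector space $\mathbf{A}$ with the same unit and product $m\,\Psi$, $\Psi\,\Pi^{\otimes2}=\Pi^{\otimes2}\psi$.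 Admissibility for $\mathcal{A}_\psi$ refers to the canonical epimorphism $\mathbf{A}_1^\otimes\twoheadrightarrow\mathbf{A}_\psi$ of algebras. *)

(* Defs.v *)
From HB Require Import structures.
From mathcomp Require Import all_boot all_order all_algebra.
From mathcomp Require Import boolp classical_sets reals.
From mathcomp Require Import complex.
From mathcomp Require Import freeg.

Set Implicit Arguments.
Unset Strict Implicit.
Unset Printing Implicit Defensive.

Import GRing.Theory.
Local Open Scope ring_scope.
Local Open Scope classical_set_scope.
Local Open Scope quotient_scope.

(* The ground field is R or C, R being an arbitrary real number structure. *)
Variant ground_field := Reals | Complexes.

Definition scalars (R : realType) (k : ground_field) : fieldType :=
  match k with Reals => R | Complexes => R[i] end.

Section LinearAlgebra.
Variable K : fieldType.
Implicit Types U V W P : lmodType K.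

Fact lin_of_subproof U V (f : U -> V) : linear f -> {g : {linear U -> V} | g =1 f}.
Proof.
move=> fL.
by exists (HB.pack_for {linear U -> V} f (GRing.isLinear.Build K U V *:%R f fL)).
Qed.

Definition mklin U V (f : U -> V) (fL : linear f) : {linear U -> V} :=
  sval (lin_of_subproof fL).

Lemma mklinE U V (f : U -> V) (fL : linear f) : mklin fL =1 f.
Proof. exact: svalP (lin_of_subproof fL). Qed.

Definition subspace V (S : set V) :=
  S 0 /\ forall c x y, S x -> S y -> S (c *: x + y).

(* Linear span, as the intersection of the subspaces containing S. *)
Definition lspan V (S : set V) : set V :=
  [set x | forall W : set V, subspace W -> S `<=` W -> W x].

Lemma lspan_subspace V (S : set V) : subspace (lspan S).
Proof.
split=> [W [W0 _] _ //|c x y Sx Sy W hW SW].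
by apply: hW.2; [apply: Sx|apply: Sy].
Qed.

Lemma sub_lspan V (S : set V) : S `<=` lspan S.
Proof. by move=> x Sx W _; apply. Qed.

Lemma lspan_min V (S W : set V) : subspace W -> S `<=` W -> lspan S `<=` W.
Proof. by move=> hW SW x; apply. Qed.

Lemma subspaceD V (S : set V) x y : subspace S -> S x -> S y -> S (x + y).
Proof. by move=> hS Sx Sy; rewrite -[x]scale1r; apply: hS.2. Qed.

Lemma subspaceZ V (S : set V) c x : subspace S -> S x -> S (c *: x).
Proof. by move=> hS Sx; rewrite -[_ *: _]addr0; apply: hS.2 => //; case: hS. Qed.

Lemma subspace_eq U V (f g : U -> V) : linear f -> linear g ->
  subspace [set x | f x = g x].
Proof.
move=> fl gl; split=> [|c x y /= fx fy]; last by rewrite fl gl fx fy.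
rewrite /= (_ : 0 = 0 *: 0 + 0 :> U); last by rewrite scaler0 addr0.
suff h (k : U -> V) : linear k -> k 0 = 0 by rewrite scaler0 addr0 !h.
by move=> kl; have := kl (-1) 0 0; rewrite scaleN1r addNr scaleN1r addNr.
Qed.

Lemma linear_comb U V (c : K) (f g : U -> V) : linear f -> linear g ->
  linear (fun x => c *: f x + g x).
Proof.
by move=> fl gl d x y; rewrite fl gl !scalerDr !scalerA [c * d]mulrC addrACA.
Qed.

Lemma subspace_preim U V (f : U -> V) (W : set V) : linear f -> subspace W ->
  subspace (f @^-1` W).
Proof.
move=> fl hW; split=> [|c x y /= fx fy]; last by rewrite fl; apply: hW.2.
suff -> : (f @^-1` W) 0 = W 0 by case: hW.
congr W; by have := fl (-1) 0 0; rewrite scaleN1r addNr scaleN1r addNr.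
Qed.

Section QuotientConstruction.
Variables (V : lmodType K) (S : set V).

Definition lspanb : {pred V} := fun x => `[< lspan S x >].

Fact lspanb_zmod : zmod_closed lspanb.
Proof.
split=> [|x y /asboolP Sx /asboolP Sy]; apply/asboolP; first by case: (lspan_subspace S).
by rewrite addrC -scaleN1r; apply: (lspan_subspace S).2.
Qed.
HB.instance Definition _ := GRing.isZmodClosed.Build V lspanb lspanb_zmod.

Definition qtype := Quotient.quot lspanb.
HB.instance Definition _ := GRing.Zmodule.on qtype.

Definition qpi (x : V) : qtype := \pi_qtype x.

Lemma qpi_eq x y : qpi x = qpi y <-> lspan S (x - y).
Proof.
rewrite /qpi; split.
  by move=> h; apply/asboolP; have := Quotient.idealrBE lspanb x y; rewrite h eqxx.
move=> /asboolP h; apply/eqP; rewrite -Quotient.idealrBE; exact: h.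
Qed.

Lemma qpi_surj (y : qtype) : exists x, qpi x = y.
Proof. by exists (repr y); rewrite /qpi reprK. Qed.

Lemma qpiD x y : qpi (x + y) = qpi x + qpi y.
Proof. exact: (raddfD (\pi_qtype)). Qed.

Definition qscale c (y : qtype) : qtype := qpi (c *: repr y).

Lemma qscaleE c x : qscale c (qpi x) = qpi (c *: x).
Proof.
apply/qpi_eq; rewrite -scalerBr; apply: (subspaceZ _ (lspan_subspace S)).
by apply/qpi_eq; rewrite /qpi reprK.
Qed.

Fact qscaleA a b v : qscale a (qscale b v) = qscale (a * b) v.
Proof. by case: (qpi_surj v) => x <-; rewrite !qscaleE scalerA. Qed.
Fact qscale1 : left_id 1 qscale.
Proof. by move=> v; case: (qpi_surj v) => x <-; rewrite !qscaleE scale1r. Qed.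
Fact qscaleDr : right_distributive qscale +%R.
Proof.
move=> a u v; case: (qpi_surj u) => x <-; case: (qpi_surj v) => y <-.
by rewrite -qpiD !qscaleE scalerDr qpiD.
Qed.
Fact qscaleDl v : {morph qscale^~ v : a b / a + b}.
Proof.
by move=> a b; case: (qpi_surj v) => x <-; rewrite !qscaleE scalerDl qpiD.
Qed.
HB.instance Definition _ := GRing.Zmodule_isLmodule.Build K qtype
  qscaleA qscale1 qscaleDr qscaleDl.

Lemma qpi_linear : linear qpi.
Proof. by move=> c x y; rewrite qpiD -qscaleE. Qed.
HB.instance Definition _ := GRing.isLinear.Build K V qtype *:%R qpi qpi_linear.

End QuotientConstruction.

(* The quotient of V by the span of S. It is used below through this interface
   only; keeping the construction opaque avoids unfolding it in unification. *)
Record quotient V (S : set V) := MkQuotient {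
  lquot : lmodType K;
  lpi : {linear V -> lquot};
  lpi_surj : forall y, exists x, lpi x = y;
  lpi_eq : forall x y, lpi x = lpi y <-> lspan S (x - y)
}.

Fact quotient_subproof V (S : set V) : quotient S.
Proof. exact: (@MkQuotient _ _ _ (qpi S) (@qpi_surj _ S) (@qpi_eq _ S)). Qed.

Section QuotientLift.
Variables (V : lmodType K) (S : set V) (Q : quotient S) (P : lmodType K).
Variable f : {linear V -> P}.
Hypothesis f_rel : forall x, S x -> f x = 0.

Fact llift_subproof y : exists z, forall x, lpi Q x = y -> f x = z.
Proof.
case: (lpi_surj y) => x <-; exists (f x) => x' /lpi_eq.
move=> /(_ [set x | f x = 0]) h; apply/eqP; rewrite -subr_eq0 -linearB; apply/eqP/h.
  split=> [|c a b /= fa fb]; first exact: linear0.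
  by rewrite linearP fa fb scaler0 addr0.
exact: f_rel.
Qed.

Definition llift y : P := projT1 (cid (llift_subproof y)).

Lemma lliftE x : llift (lpi Q x) = f x.
Proof. by rewrite /llift; case: cid => z /= /(_ x erefl). Qed.

Lemma llift_linear : linear llift.
Proof.
move=> c u v; case: (lpi_surj u) => x <-; case: (lpi_surj v) => y <-.
by rewrite -linearP !lliftE linearP.
Qed.
End QuotientLift.

Section FreeModule.
Variables (X : choiceType).

Lemma freeg_span (W : set {freeg X / K}) : subspace W ->
  (forall x, W << x >>) -> forall u, W u.
Proof.
move=> hW Wx u; elim/freeg_ind_dom0: u => [|k x D _ _ WD]; first by case: hW.
suff -> : << k *g x >> = k *: << x >> :> {freeg X / K} by apply: hW.2.
apply/eqP/freeg_eqP => y; rewrite coeffZ !coeffU.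
by rewrite mul1r.
Qed.

Lemma fglift_linear P (f : X -> P) : linear (fglift f : {freeg X / K} -> P).
Proof.
have fB : {morph (fglift f : {freeg X / K} -> P) : u v / u - v} := lift_is_additive f.
have f0 : fglift f 0 = 0 by have := fB 0 0; rewrite !subrr.
have fN : {morph (fglift f : {freeg X / K} -> P) : u / - u}.
  by move=> u; have := fB 0 u; rewrite !sub0r f0 sub0r.
have fD : {morph (fglift f : {freeg X / K} -> P) : u v / u + v}.
  by move=> u v; rewrite -[v in LHS]opprK fB fN opprK.
move=> c u v; rewrite fD; congr (_ + _).
elim/freeg_ind_dom0: u => [|k x D _ _ IH]; first by rewrite scaler0 f0 scaler0.
rewrite scalerDr !fD IH scalerDr; congr (_ + _).
suff -> : c *: << k *g x >> = << c * k *g x >> :> {freeg X / K}.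
  by rewrite !liftU scalerA.
by apply/eqP/freeg_eqP => y; rewrite coeffZ !coeffU mulrA.
Qed.
HB.instance Definition _ P (f : X -> P) :=
  GRing.isLinear.Build K {freeg X / K} P *:%R (fglift f) (fglift_linear f).

Lemma fgliftU P (f : X -> P) x : fglift f << x >> = f x :> P.
Proof. by rewrite liftU scale1r. Qed.
End FreeModule.

Section Tensor.
Variables M N : lmodType K.

(* M (x) N is the free module on M * N modulo bilinearity. The library has no
   tensor product of possibly infinite-dimensional spaces. *)
Definition bilinear_rel : set {freeg (M * N) / K} := [set u |
  (exists c x x' y,
     u = << (c *: x + x', y) >> - (c *: << (x, y) >> + << (x', y) >>)) \/
  (exists c x y y',
     u = << (x, c *: y + y') >> - (c *: << (x, y) >> + << (x, y') >>))].

Definition tensor_quotient : quotient bilinear_rel := quotient_subproof _.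

Definition tensor : lmodType K := lquot tensor_quotient.

Definition tens (x : M) (y : N) : tensor := lpi tensor_quotient << (x, y) >>.

Lemma tens_linearl y : linear (tens^~ y).
Proof.
move=> c x x'; rewrite /tens -linearP; apply/lpi_eq; apply: sub_lspan.
by rewrite /bilinear_rel /=; left; exists c, x, x', y.
Qed.

Lemma tens_linearr x : linear (tens x).
Proof.
move=> c y y'; rewrite /tens -linearP; apply/lpi_eq; apply: sub_lspan.
by rewrite /bilinear_rel /=; right; exists c, x, y, y'.
Qed.

Section Lift.
Variables (P : lmodType K) (f : M -> N -> P).
Hypotheses (fl : forall y, linear (f^~ y)) (fr : forall x, linear (f x)).

Fact bilinear_rel_lift u :
  bilinear_rel u -> fglift (fun p : M * N => f p.1 p.2) u = 0.
Proof.
by rewrite /bilinear_rel /= => -[] [c [x [y [z ->]]]]; rewrite linearB linearP /= !fgliftU /= ?fl ?fr subrr.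
Qed.

Definition tlift : {linear tensor -> P} :=
  mklin (llift_linear (Q := tensor_quotient) bilinear_rel_lift).

Lemma tliftE x y : tlift (tens x y) = f x y.
Proof. by rewrite mklinE (lliftE tensor_quotient bilinear_rel_lift) /= fgliftU. Qed.
End Lift.

Lemma tensor_ind (W : set tensor) : subspace W ->
  (forall x y, W (tens x y)) -> forall u, W u.
Proof.
move=> hW Wt u; case: (lpi_surj u) => x <-.
apply: (@freeg_span _ (lpi tensor_quotient @^-1` W)) => [|[a b]]; last exact: Wt.
exact: subspace_preim (linearP _) hW.
Qed.
End Tensor.

Lemma tensor_ext M N P (f g : tensor M N -> P) : linear f -> linear g ->
  (forall x y, f (tens x y) = g (tens x y)) -> f =1 g.
Proof. by move=> fl gl fg; apply: tensor_ind => //; apply: subspace_eq. Qed.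

Section TensorMap.
Variables (M N M' N' : lmodType K) (f : {linear M -> M'}) (g : {linear N -> N'}).

Fact tmap_linearl y : linear (fun x => tens (f x) (g y)).
Proof. by move=> c x x'; rewrite linearP tens_linearl. Qed.
Fact tmap_linearr x : linear (fun y => tens (f x) (g y)).
Proof. by move=> c y y'; rewrite linearP tens_linearr. Qed.

Definition tmap : {linear tensor M N -> tensor M' N'} :=
  tlift tmap_linearl tmap_linearr.

Lemma tmapE x y : tmap (tens x y) = tens (f x) (g y).
Proof. exact: tliftE. Qed.
End TensorMap.

Arguments tmap {M N M' N'} f g.

Section TensorAlgebra.
Variable V : lmodType K.

(* The tensor algebra of V is the free module on the words in elements of V
   modulo multilinearity in the letters; [word [:: v1; ...; vr]] stands for the
   pure tensor v1 (x) ... (x) vr, and the product is concatenation. *)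
Definition multilinear_rel : set {freeg (seq V) / K} := [set u |
  exists c v w s t,
    u = << s ++ (c *: v + w) :: t >> - (c *: << s ++ v :: t >> + << s ++ w :: t >>)].

Definition talg_quotient : quotient multilinear_rel := quotient_subproof _.

Definition talg : lmodType K := lquot talg_quotient.

Definition word (s : seq V) : talg := lpi talg_quotient << s >>.

Definition multilinear P (f : seq V -> P) := forall c v w s t,
  f (s ++ (c *: v + w) :: t) = c *: f (s ++ v :: t) + f (s ++ w :: t).

Lemma word_multilinear : multilinear word.
Proof.
move=> c v w s t; rewrite /word -linearP; apply/lpi_eq; apply: sub_lspan.
by exists c, v, w, s, t.
Qed.

Section Lift.
Variables (P : lmodType K) (f : seq V -> P) (fM : multilinear f).

Fact multilinear_rel_lift u : multilinear_rel u -> fglift f u = 0.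
Proof.
by rewrite /multilinear_rel /= => -[c [v [w [s [t ->]]]]]; rewrite linearB linearP /= !fgliftU fM subrr.
Qed.

Definition wlift : {linear talg -> P} := mklin (llift_linear (Q := talg_quotient) multilinear_rel_lift).

Lemma wliftE s : wlift (word s) = f s.
Proof. by rewrite mklinE (lliftE talg_quotient multilinear_rel_lift) /= fgliftU. Qed.
End Lift.

Lemma talg_ind (W : set talg) : subspace W ->
  (forall s, W (word s)) -> forall u, W u.
Proof.
move=> hW Wt u; case: (lpi_surj u) => x <-.
apply: (@freeg_span _ (lpi talg_quotient @^-1` W)) => [|s]; last exact: Wt.
exact: subspace_preim (linearP _) hW.
Qed.

Lemma talg_ext P (f g : talg -> P) : linear f -> linear g ->
  (forall s, f (word s) = g (word s)) -> f =1 g.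
Proof. by move=> fl gl fg; apply: talg_ind => //; apply: subspace_eq. Qed.

Fact wordcat_ml t : multilinear (fun s => word (s ++ t)).
Proof. by move=> c v w s s'; rewrite -!catA !cat_cons word_multilinear. Qed.
Fact wordcat_mr s : multilinear (fun t => word (s ++ t)).
Proof. by move=> c v w t t'; rewrite !catA word_multilinear. Qed.

Definition lmulw s : {linear talg -> talg} := wlift (wordcat_mr s).

Lemma lmulwE s t : lmulw s (word t) = word (s ++ t).
Proof. exact: wliftE. Qed.

Fact lmulw_ml y : multilinear (fun s => lmulw s y).
Proof.
move=> c v w s t; move: y; apply: talg_ext => [||s'].
- exact: linearP.
- by apply: linear_comb; apply: linearP.
by rewrite !lmulwE wordcat_ml.
Qed.

Definition tprod x y : talg := wlift (lmulw_ml y) x.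

Lemma tprod_linearl y : linear (tprod^~ y).
Proof. by move=> c x x'; rewrite /tprod linearP. Qed.

Lemma tprod_linearr x : linear (tprod x).
Proof.
move=> c y y'; move: x; apply: talg_ext => [||s].
- exact: tprod_linearl.
- by apply: linear_comb; apply: tprod_linearl.
by rewrite /tprod !wliftE linearP.
Qed.

Lemma tprodE s t : tprod (word s) (word t) = word (s ++ t).
Proof. by rewrite /tprod wliftE lmulwE. Qed.

Definition tmul : {linear tensor talg talg -> talg} :=
  tlift tprod_linearl tprod_linearr.

Lemma tmulE x y : tmul (tens x y) = tprod x y.
Proof. exact: tliftE. Qed.

Lemma tprodA : associative tprod.
Proof.
move=> x y z; move: x; apply: talg_ext => [||s].
- exact: tprod_linearl.
- by move=> c x x'; rewrite !tprod_linearl.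
move: y; apply: talg_ext => [||t].
- by move=> c y y'; rewrite tprod_linearl tprod_linearr.
- by move=> c y y'; rewrite tprod_linearr tprod_linearl.
move: z; apply: talg_ext => [||u].
- by move=> c z z'; rewrite !tprod_linearr.
- by move=> c z z'; rewrite tprod_linearr.
by rewrite !tprodE catA.
Qed.

Definition tone : talg := word [::].

Lemma tprod1l : left_id tone tprod.
Proof. by apply: talg_ext => [||s]; [exact: tprod_linearr| |rewrite tprodE]. Qed.

Lemma tprod1r : right_id tone tprod.
Proof. by apply: talg_ext => [||s]; [exact: tprod_linearl| |rewrite tprodE cats0]. Qed.

(* [tpow r] is the r-th tensor power of V inside the tensor algebra, and
   [tpow2 (r, s)] is (tpow r) (x) (tpow s) inside talg (x) talg. *)
Definition tpow r : set talg := lspan [set word s | s in [set s | size s = r]].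

Definition tpow2 (rs : nat * nat) : set (tensor talg talg) :=
  lspan [set u | exists a b, [/\ tpow rs.1 a, tpow rs.2 b & u = tens a b]].

Lemma tpow_subspace r : subspace (tpow r).
Proof. exact: lspan_subspace. Qed.

Lemma tpow2_subspace rs : subspace (tpow2 rs).
Proof. exact: lspan_subspace. Qed.

Lemma tpow_word s : tpow (size s) (word s).
Proof. by apply: sub_lspan; exists s. Qed.
Arguments tpow_word s W _ _ : clear implicits.

Lemma tpow_ind r (W : set talg) : subspace W ->
  (forall s, size s = r -> W (word s)) -> tpow r `<=` W.
Proof. by move=> hW Ws; apply: lspan_min => // _ [s /= ? <-]; apply: Ws. Qed.

Lemma tpow2_tens r s a b : tpow r a -> tpow s b -> tpow2 (r, s) (tens a b).
Proof. by move=> ra sb; apply: sub_lspan; exists a, b. Qed.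

Lemma tpow2_ind r s (W : set (tensor talg talg)) : subspace W ->
  (forall a b, tpow r a -> tpow s b -> W (tens a b)) -> tpow2 (r, s) `<=` W.
Proof. by move=> hW Wt; apply: lspan_min => // _ [a [b [? ? ->]]]; apply: Wt. Qed.

Lemma tensor_word_ind (W : set (tensor talg talg)) : subspace W ->
  (forall s t, W (tens (word s) (word t))) -> forall u, W u.
Proof.
move=> hW Wt; apply: tensor_ind => // x y.
apply: (@talg_ind [set x | W (tens x y)]) => [|s].
  exact: (subspace_preim (tens_linearl y)).
apply: (@talg_ind [set y | W (tens (word s) y)]) => [|t]; last exact: Wt.
exact: (subspace_preim (tens_linearr _)).
Qed.

Lemma tensor_word_ext P (f g : tensor talg talg -> P) : linear f -> linear g ->
  (forall s t, f (tens (word s) (word t)) = g (tens (word s) (word t))) -> f =1 g.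
Proof. by move=> fl gl fg; apply: tensor_word_ind => //; apply: subspace_eq. Qed.

Lemma tpow_tprod r s a b : tpow r a -> tpow s b -> tpow (r + s) (tprod a b).
Proof.
move=> + sb; move: a; apply: tpow_ind => [|w <-].
  exact: (subspace_preim (tprod_linearl b) (tpow_subspace _)).
move: b sb; apply: tpow_ind => [|t <-].
  exact: (subspace_preim (tprod_linearr _) (tpow_subspace _)).
by rewrite tprodE -size_cat; apply: tpow_word.
Qed.

Lemma tpow_tmul r s u : tpow2 (r, s) u -> tpow (r + s) (tmul u).
Proof.
move: u; apply: tpow2_ind => [|a b ra sb]; last by rewrite tmulE; apply: tpow_tprod.
exact: (subspace_preim (@linearP _ _ _ _ tmul) (tpow_subspace _)).
Qed.

(* [cut r] splits a word after its r-th letter: by cutK and tmulK it is inverse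
   to the multiplication (tpow r) (x) (tpow s) -> tpow (r + s) for every s. *)
Fact cut_multilinear n :
  multilinear (fun s => tens (word (take n s)) (word (drop n s))).
Proof.
move=> c v w s t; rewrite !take_cat !drop_cat; case: ltnP => _.
  by rewrite word_multilinear tens_linearr.
case: (n - size s)%N => [|k] /=.
  by have /= -> := word_multilinear c v w [::] t; rewrite tens_linearr.
by rewrite word_multilinear tens_linearl.
Qed.

Definition cut n : {linear talg -> tensor talg talg} := wlift (cut_multilinear n).

Lemma cutE n s : cut n (word s) = tens (word (take n s)) (word (drop n s)).
Proof. exact: wliftE. Qed.

Lemma cutK n : cancel (cut n) tmul.
Proof.
apply: talg_ext => [||s]; [by move=> c x y; rewrite !linearP|by []|].
by rewrite cutE tmulE tprodE cat_take_drop.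
Qed.

Lemma tmulK r s u : tpow2 (r, s) u -> cut r (tmul u) = u.
Proof.
move: u; apply: tpow2_ind => [|a b].
  by apply: subspace_eq => // c x y; rewrite !linearP.
move=> + sb; move: a; apply: tpow_ind => [|w wr].
  apply: subspace_eq => [c x y|]; last exact: tens_linearl.
  by rewrite tens_linearl !linearP.
move: b sb; apply: tpow_ind => [|t _].
  apply: subspace_eq => [c x y|]; last exact: tens_linearr.
  by rewrite tens_linearr !linearP.
by rewrite tmulE tprodE cutE -wr take_size_cat ?drop_size_cat.
Qed.

Lemma tmul_inj r s u v : tpow2 (r, s) u -> tpow2 (r, s) v -> tmul u = tmul v -> u = v.
Proof. by move=> hu hv /(congr1 (cut r)); rewrite !(tmulK (s := s)). Qed.

Lemma cut_tpow2 r s x : tpow (r + s) x -> tpow2 (r, s) (cut r x).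
Proof.
move: x; apply: tpow_ind => [|w wrs].
  exact: (subspace_preim (@linearP _ _ _ _ (cut r)) (tpow2_subspace _)).
have tr : size (take r w) = r by rewrite size_takel ?wrs ?leq_addr.
have ds : size (drop r w) = s by rewrite size_drop wrs addKn.
rewrite cutE; apply: tpow2_tens.
  by have := tpow_word (take r w); rewrite tr.
by have := tpow_word (drop r w); rewrite ds.
Qed.

Lemma tmap_tpow2 r s r' s' (f g : {linear talg -> talg}) :
  (forall a, tpow r a -> tpow r' (f a)) -> (forall b, tpow s b -> tpow s' (g b)) ->
  forall u, tpow2 (r, s) u -> tpow2 (r', s') (tmap f g u).
Proof.
move=> hf hg; apply: tpow2_ind => [|a b ra sb].
  exact: (subspace_preim (@linearP _ _ _ _ (tmap f g)) (tpow2_subspace _)).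
by rewrite tmapE; apply: tpow2_tens; [apply: hf|apply: hg].
Qed.

End TensorAlgebra.

Section GradedAutomorphisms.
Variables (U : lmodType K) (I : Type) (G : I -> set U).

Record graut := Graut {
  graut_map :> {linear U -> U};
  graut_bij : bijective graut_map;
  graut_pres : forall i, graut_map @` G i = G i
}.

Lemma graut_in (f : graut) i x : G i x -> G i (f x).
Proof. by move=> Gx; rewrite -(graut_pres f); exists x. Qed.

Fact mkgraut_bij (f g : {linear U -> U}) : cancel f g -> cancel g f -> bijective f.
Proof. by exists g. Qed.

Fact mkgraut_pres (f g : {linear U -> U}) : cancel g f ->
  (forall i x, G i x -> G i (f x)) -> (forall i x, G i x -> G i (g x)) ->
  forall i, f @` G i = G i.
Proof.
move=> gK hf hg i; apply/seteqP; split=> [_ [x Gx <-]|x Gx]; first exact: hf.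
by exists (g x); [apply: hg|apply: gK].
Qed.

Definition mkgraut (f g : {linear U -> U}) (fK : cancel f g) (gK : cancel g f)
    (hf : forall i x, G i x -> G i (f x)) (hg : forall i x, G i x -> G i (g x)) :
  graut := Graut (mkgraut_bij fK gK) (mkgraut_pres gK hf hg).

Fact graut_inv_ex (f : graut) : exists g, cancel f g /\ cancel g f.
Proof. by case: (graut_bij f) => g ? ?; exists g. Qed.

Definition graut_invf (f : graut) : U -> U := projT1 (cid (graut_inv_ex f)).

Fact graut_invfK (f : graut) : cancel f (graut_invf f).
Proof. by rewrite /graut_invf; case: cid => g []. Qed.

Fact graut_invfKV (f : graut) : cancel (graut_invf f) f.
Proof. by rewrite /graut_invf; case: cid => g []. Qed.

Fact graut_invf_linear (f : graut) : linear (graut_invf f).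
Proof. exact: can2_linear (graut_invfK f) (graut_invfKV f). Qed.

Fact graut_invf_in (f : graut) i x : G i x -> G i (graut_invf f x).
Proof. by rewrite -{1}(graut_pres f) => -[y Gy <-]; rewrite graut_invfK. Qed.

Definition graut_invl (f : graut) : {linear U -> U} := mklin (graut_invf_linear f).

Fact graut_invlK (f : graut) : cancel f (graut_invl f).
Proof. by move=> x; rewrite mklinE graut_invfK. Qed.

Fact graut_invlKV (f : graut) : cancel (graut_invl f) f.
Proof. by move=> x; rewrite mklinE graut_invfKV. Qed.

Fact graut_invl_in (f : graut) i x : G i x -> G i (graut_invl f x).
Proof. by rewrite mklinE; apply: graut_invf_in. Qed.

Definition graut_inv (f : graut) : graut :=
  @mkgraut (graut_invl f) f (graut_invlKV f) (graut_invlK f)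
    (@graut_invl_in f) (@graut_in f).

Lemma grautK (f : graut) : cancel f (graut_inv f).
Proof. exact: graut_invlK. Qed.

Lemma grautKV (f : graut) : cancel (graut_inv f) f.
Proof. exact: graut_invlKV. Qed.

Fact graut_comp_bij (f g : graut) : bijective (f \o g).
Proof. exact: bij_comp (graut_bij f) (graut_bij g). Qed.

Fact graut_comp_pres (f g : graut) i : (f \o g) @` G i = G i.
Proof. by rewrite -(image_comp g f) !graut_pres. Qed.

Definition graut_comp (f g : graut) : graut :=
  @Graut (f \o g : {linear U -> U}) (graut_comp_bij f g) (graut_comp_pres f g).

Lemma graut_compE f g x : graut_comp f g x = f (g x).
Proof. by []. Qed.
End GradedAutomorphisms.

End LinearAlgebra.

Arguments tmap {K M N M' N'} f g.
Arguments tmul {K V}.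
Arguments cut {K V} n.
Arguments tpow {K V} r.
Arguments tpow2 {K V} rs.
Arguments tone {K} V.
Arguments tpow_word {K V} s W _ _.

Section Cochains.
Variables (K : fieldType) (V : lmodType K).
Implicit Type P : lmodType K.

(* [graut G] is the group of linear automorphisms mapping each G i onto itself. *)
Definition C1 := graut (tpow (V := V)).
Definition C2 := graut (tpow2 (V := V)).

Implicit Types (theta eta : C1) (psi phi : C2).

Lemma c1_in theta r x : tpow r x -> tpow r (theta x).
Proof. exact: (graut_in theta). Qed.

Lemma c2_in psi rs u : tpow2 rs u -> tpow2 rs (psi u).
Proof. exact: (graut_in psi). Qed.

Fact sqK theta eta : cancel theta eta -> cancel (tmap theta theta) (tmap eta eta).
Proof.
move=> hK; apply: tensor_ext => [||x y]; [by move=> c x y; rewrite !linearP|by []|].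
by rewrite !tmapE !hK.
Qed.

Fact sq_in theta rs u : tpow2 rs u -> tpow2 rs (tmap theta theta u).
Proof. by case: rs => r s; apply: tmap_tpow2 => a; apply: c1_in. Qed.

Definition sq theta : C2 :=
  mkgraut (sqK (grautK theta)) (sqK (grautKV theta)) (@sq_in theta)
    (@sq_in (graut_inv theta)).

Lemma sq_def theta u : sq theta u = tmap theta theta u.
Proof. by []. Qed.

Lemma sqE theta x y : sq theta (tens x y) = tens (theta x) (theta y).
Proof. exact: tmapE. Qed.

Lemma sqVE theta x y : graut_inv (sq theta) (tens x y) =
  tens (graut_inv theta x) (graut_inv theta y).
Proof. by apply: (can_inj (grautK (sq theta))); rewrite grautKV sqE !grautKV. Qed.

(* [conj_tmul theta] is, on each (tpow r) (x) (tpow s), the operator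
   cut r \o theta \o tmul, i.e. theta_(r+s) seen on V^(x)r (x) V^(x)s. *)
Fact bicut_multilinear theta y :
  multilinear (fun s => cut (size s) (theta (tprod (word s) y))).
Proof.
move=> c v w s t; rewrite word_multilinear tprod_linearl !linearP /=.
by rewrite !size_cat.
Qed.

Definition bicut theta x y := wlift (bicut_multilinear theta y) x.

Fact bicut_linearl theta y : linear (bicut theta ^~ y).
Proof. by move=> c x x'; rewrite /bicut linearP. Qed.

Fact bicut_linearr theta x : linear (bicut theta x).
Proof.
move=> c y y'; move: x; apply: talg_ext => [||s].
- exact: bicut_linearl.
- by apply: linear_comb; apply: bicut_linearl.
by rewrite /bicut !wliftE tprod_linearr !linearP.
Qed.

Definition conj_tmul theta : {linear tensor (talg V) (talg V) -> tensor (talg V) (talg V)} :=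
  tlift (bicut_linearl theta) (bicut_linearr theta).

Lemma conj_tmulE theta r s u : tpow2 (r, s) u -> conj_tmul theta u = cut r (theta (tmul u)).
Proof.
move: u; apply: tpow2_ind => [|a b ra _].
  by apply: subspace_eq => c x y; rewrite !linearP.
rewrite tliftE tmulE; move: a ra; apply: tpow_ind => [|w wr].
  apply: subspace_eq => [|c x y]; first exact: bicut_linearl.
  by rewrite tprod_linearl !linearP.
by rewrite /bicut wliftE wr.
Qed.

Fact conj_tmul_in theta rs u : tpow2 rs u -> tpow2 rs (conj_tmul theta u).
Proof.
case: rs => r s ru; rewrite (conj_tmulE _ ru).
by apply: cut_tpow2; apply: c1_in; apply: tpow_tmul.
Qed.

Lemma tmul_conj_tmul theta u : tmul (conj_tmul theta u) = theta (tmul u).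
Proof.
move: u; apply: tensor_word_ext => [||s t]; try by move=> c x y; rewrite !linearP.
by rewrite (conj_tmulE _ (tpow2_tens (tpow_word s) (tpow_word t))) cutK.
Qed.

Fact conj_tmulK theta eta : cancel theta eta -> cancel (conj_tmul theta) (conj_tmul eta).
Proof.
move=> hK; apply: tensor_word_ext => [||s t]; [by move=> c x y; rewrite !linearP|by []|].
have st := tpow2_tens (tpow_word s) (tpow_word t).
rewrite (conj_tmulE _ (conj_tmul_in theta st)) tmul_conj_tmul hK.
exact: (tmulK st).
Qed.

Definition conj_tmul_aut theta : C2 :=
  mkgraut (conj_tmulK (grautK theta)) (conj_tmulK (grautKV theta))
    (fun rs => @conj_tmul_in theta rs) (@conj_tmul_in (graut_inv theta)).

Lemma conj_tmul_autE theta u : conj_tmul_aut theta u = conj_tmul theta u.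
Proof. by []. Qed.

(* See coboundary_component for the defining formula of the coboundary. *)
Definition coboundary theta : C2 :=
  graut_comp (conj_tmul_aut theta) (graut_inv (sq theta)).

(* psi_(r,s) and f_r (x) g_s as operators on tpow (r + s), through the
   identification of (tpow r) (x) (tpow s) with tpow (r + s) by multiplication;
   they are meaningful on tpow (r + s) only. *)
Definition component psi (r s : nat) : {linear talg V -> talg V} :=
  tmul \o psi \o cut r.

Definition otimes (r s : nat) (f g : {linear talg V -> talg V}) :
    {linear talg V -> talg V} :=
  tmul \o tmap f g \o cut r.

Lemma comp_def psi r s x : component psi r s x = tmul (psi (cut r x)).
Proof. by []. Qed.

Lemma otimes_def r s f g x : otimes r s f g x = tmul (tmap f g (cut r x)).
Proof. by []. Qed.

Lemma coboundary_component theta r s x : tpow (r + s) x ->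
  component (coboundary theta) r s x =
  theta (otimes r s (graut_inv theta) (graut_inv theta) x).
Proof.
move=> /cut_tpow2 hx; rewrite comp_def otimes_def graut_compE conj_tmul_autE.
rewrite tmul_conj_tmul; congr (theta (tmul _)); move: (cut r x).
apply: tensor_ext => [||a b]; try by move=> c u v; rewrite !linearP.
by rewrite sqVE tmapE.
Qed.

Lemma component_inj psi phi :
  (forall r s x, tpow (r + s) x -> component psi r s x = component phi r s x) ->
  psi =1 phi.
Proof.
move=> h; apply: tensor_word_ext => [||s t]; try exact: linearP.
have st := tpow2_tens (tpow_word s) (tpow_word t).
apply: (tmul_inj (c2_in psi st) (c2_in phi st)).
by have := h _ _ _ (tpow_tmul st); rewrite !comp_def (tmulK st).
Qed.

Definition cocycle psi := forall r s t x, tpow (r + s + t) x ->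
  component psi (r + s) t (otimes (r + s) t (component psi r s) idfun x) =
  component psi r (s + t) (otimes r (s + t) idfun (component psi s t) x).

Definition counital psi := forall a,
  psi (tens (tone V) a) = tens (tone V) a /\ psi (tens a (tone V)) = tens a (tone V).

Definition is_primitive psi theta :=
  [/\ forall x, tpow 0 x -> theta x = x, forall x, tpow 1 x -> theta x = x
    & psi =1 coboundary theta].

Definition tmulby psi a b := tmul (psi (tens a b)).

Lemma tmulby_linearl psi b : linear (tmulby psi ^~ b).
Proof. by move=> c x y; rewrite /tmulby tens_linearl !linearP. Qed.

Lemma tmulby_linearr psi a : linear (tmulby psi a).
Proof. by move=> c x y; rewrite /tmulby tens_linearr !linearP. Qed.

Lemma tpow_tmulby psi r s a b : tpow r a -> tpow s b -> tpow (r + s) (tmulby psi a b).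
Proof. by move=> ra sb; exact: tpow_tmul (c2_in psi (tpow2_tens ra sb)). Qed.

Lemma cut_tprod r s (a b : talg V) : tpow r a -> tpow s b ->
  cut r (tprod a b) = tens a b.
Proof. by move=> ra sb; rewrite -tmulE (tmulK (tpow2_tens ra sb)). Qed.

Lemma componentE psi r s a b : tpow r a -> tpow s b ->
  component psi r s (tprod a b) = tmulby psi a b.
Proof. by move=> ra sb; rewrite comp_def (cut_tprod ra sb). Qed.

Lemma otimesE r s f g a b : tpow r a -> tpow s b ->
  otimes r s f g (tprod a b) = tprod (f a) (g b).
Proof. by move=> ra sb; rewrite otimes_def (cut_tprod ra sb) tmapE tmulE. Qed.

Lemma cocycleP psi : cocycle psi <-> associative (tmulby psi).
Proof.
pose lhs := (componentE, otimesE).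
have E r s t a b c : tpow r a -> tpow s b -> tpow t c ->
    component psi (r + s) t (otimes (r + s) t (component psi r s) idfun
      (tprod (tprod a b) c)) = tmulby psi (tmulby psi a b) c /\
    component psi r (s + t) (otimes r (s + t) idfun (component psi s t)
      (tprod (tprod a b) c)) = tmulby psi a (tmulby psi b c).
  move=> ra sb tc; have rs := tpow_tprod ra sb; have st := tpow_tprod sb tc.
  rewrite (otimesE _ _ rs tc) (componentE _ ra sb).
  rewrite (componentE _ (tpow_tmulby psi ra sb) tc).
  rewrite -tprodA (otimesE _ _ ra st) (componentE _ sb tc).
  by rewrite (componentE _ ra (tpow_tmulby psi sb tc)).
split=> [cpsi x y z|cpsi r s t].
  move: x; apply: talg_ext => [||u].
  - exact: tmulby_linearl.
  - by move=> c x x'; rewrite !tmulby_linearl.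
  move: y; apply: talg_ext => [||v].
  - by move=> c y y'; rewrite tmulby_linearl tmulby_linearr.
  - by move=> c y y'; rewrite tmulby_linearr tmulby_linearl.
  move: z; apply: talg_ext => [||w].
  - by move=> c z z'; rewrite !tmulby_linearr.
  - by move=> c z z'; rewrite tmulby_linearr.
  have [<- <-] := E _ _ _ _ _ _ (tpow_word u) (tpow_word v) (tpow_word w).
  apply/esym/cpsi; apply: tpow_tprod; last exact: tpow_word.
  by apply: tpow_tprod; apply: tpow_word.
apply: tpow_ind => [|w wrst].
  by apply: subspace_eq => c x y; rewrite !linearP.
pose a := word (take r w); pose b := word (take s (drop r w)).
pose c := word (drop s (drop r w)).
have -> : word w = tprod (tprod a b) c.
  by rewrite -tprodA !tprodE !cat_take_drop.
have wr : size (take r w) = r by rewrite size_takel // wrst -addnA leq_addr.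
have dr : size (drop r w) = (s + t)%N by rewrite size_drop wrst -addnA addKn.
have ra : tpow r a by have := tpow_word (take r w); rewrite wr.
have sb : tpow s b.
  have := tpow_word (take s (drop r w)).
  by rewrite (_ : size _ = s) // size_takel // dr leq_addr.
have tc : tpow t c.
  have := tpow_word (drop s (drop r w)).
  by rewrite (_ : size _ = t) // size_drop dr addKn.
by have [-> ->] := E _ _ _ _ _ _ ra sb tc; rewrite cpsi.
Qed.

Lemma tmulby_coboundary theta a b : tmulby (coboundary theta) a b =
  theta (tprod (graut_inv theta a) (graut_inv theta b)).
Proof.
by rewrite /tmulby graut_compE sqVE conj_tmul_autE tmul_conj_tmul tmulE.
Qed.

Lemma coboundary_cocycle theta : cocycle (coboundary theta).
Proof.
by apply/cocycleP => a b c; rewrite !tmulby_coboundary !grautK tprodA.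
Qed.

Lemma tpow_tone : tpow 0 (tone V).
Proof. exact: (tpow_word [::]). Qed.

Lemma coboundary_counital theta :
  theta (tone V) = tone V -> counital (coboundary theta).
Proof.
move=> th1; have thV1 : graut_inv theta (tone V) = tone V by rewrite -{1}th1 grautK.
move=> a; rewrite !graut_compE !sqVE thV1 !conj_tmul_autE.
rewrite -{2 4}[a](grautKV theta); move: (graut_inv theta a) => {}a.
have lc (f : {linear talg V -> talg V}) n : linear (fun x => cut n (f x)).
  by move=> c x y; rewrite !linearP.
split; move: a; apply: talg_ext => [||w]; try by
  move=> c x y; rewrite ?tens_linearl ?tens_linearr !(linearP, tens_linearl, tens_linearr).
  rewrite (conj_tmulE _ (tpow2_tens tpow_tone (tpow_word w))) tmulE tprod1l.
  have tw := c1_in theta (tpow_word w).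
  by rewrite -{1}[theta _]tprod1l (cut_tprod tpow_tone tw).
rewrite (conj_tmulE _ (tpow2_tens (tpow_word w) tpow_tone)) tmulE tprod1r.
have tw := c1_in theta (tpow_word w).
by rewrite -{1}[theta _]tprod1r (cut_tprod tw tpow_tone).
Qed.

Record Z2 := MkZ2 {
  z2_map :> graut (tpow2 (V := V));
  z2_cocycle : cocycle z2_map;
  z2_counital : counital z2_map
}.

Section Primitive.
Variable psi : Z2.

(* The primitive is built degree by degree:
   theta_(n+1) = psi_(n,1) (theta_n (x) id). *)
Fixpoint prim n : {linear talg V -> talg V} :=
  if n is m.+1 then tmul \o z2_map psi \o tmap (prim m) idfun \o cut m else idfun.

Fixpoint primV n : {linear talg V -> talg V} :=
  if n is m.+1 then tmul \o tmap (primV m) idfun \o graut_inv (z2_map psi) \o cut m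
  else idfun.

Lemma primS n x : prim n.+1 x = tmul (psi (tmap (prim n) idfun (cut n x))).
Proof. by []. Qed.

Lemma primVS n x :
  primV n.+1 x = tmul (tmap (primV n) idfun (graut_inv psi (cut n x))).
Proof. by []. Qed.

Lemma tpow1_id s (x : talg V) : tpow s x -> tpow s ((idfun : {linear talg V -> talg V}) x).
Proof. by []. Qed.

Lemma prim_in n x : tpow n x -> tpow n (prim n x).
Proof.
elim: n x => [//|n IH] x; rewrite -addn1 => /cut_tpow2 hx.
rewrite {2}addn1 primS.
exact: tpow_tmul (c2_in psi (tmap_tpow2 IH (@tpow1_id 1) hx)).
Qed.

Lemma primV_in n x : tpow n x -> tpow n (primV n x).
Proof.
elim: n x => [//|n IH] x; rewrite -addn1 => /cut_tpow2 hx.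
rewrite {2}addn1 primVS.
exact: tpow_tmul (tmap_tpow2 IH (@tpow1_id 1) (c2_in (graut_inv psi) hx)).
Qed.

Lemma tmap_cancel n (f g : {linear talg V -> talg V}) :
  (forall a, tpow n a -> g (f a) = a) ->
  forall u, tpow2 (n, 1%N) u -> tmap g idfun (tmap f idfun u) = u.
Proof.
move=> fK; apply: tpow2_ind => [|a b ra _].
  by apply: subspace_eq => // c x y; rewrite !linearP.
by rewrite !tmapE fK.
Qed.

Lemma primK n x : tpow n x -> primV n (prim n x) = x.
Proof.
elim: n x => [//|n IH] x; rewrite -addn1 => /cut_tpow2 hx.
have hy := c2_in psi (tmap_tpow2 (@prim_in n) (@tpow1_id 1) hx).
rewrite addn1 primVS primS (tmulK hy).
by rewrite grautK (tmap_cancel IH) // cutK.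
Qed.

Lemma primVK n x : tpow n x -> prim n (primV n x) = x.
Proof.
elim: n x => [//|n IH] x; rewrite -addn1 => /cut_tpow2 /(c2_in (graut_inv psi)) hx.
have hy := tmap_tpow2 (@primV_in n) (@tpow1_id 1) hx.
rewrite addn1 primS primVS (tmulK hy).
by rewrite (tmap_cancel IH) // grautKV cutK.
Qed.

Fact assemble_multilinear (F : nat -> {linear talg V -> talg V}) :
  multilinear (fun s => F (size s) (word s)).
Proof.
by move=> c v w s t; rewrite word_multilinear linearP !size_cat.
Qed.

Definition assemble F := wlift (assemble_multilinear F).

Lemma assembleE F n x : tpow n x -> assemble F x = F n x.
Proof.
move: x; apply: tpow_ind => [|s <-]; last exact: wliftE.
by apply: subspace_eq => c x y; rewrite !linearP.
Qed.

Fact assemble_in (F : nat -> {linear talg V -> talg V}) n x : (forall x, tpow n x -> tpow n (F n x)) -> tpow n x ->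
  tpow n (assemble F x).
Proof. by move=> hF hx; rewrite (assembleE _ hx); apply: hF. Qed.

Fact assembleK (F G : nat -> {linear talg V -> talg V}) :
  (forall n x, tpow n x -> tpow n (F n x)) ->
  (forall n x, tpow n x -> G n (F n x) = x) ->
  cancel (assemble F) (assemble G).
Proof.
move=> hF FK; apply: talg_ext => [||s]; [by move=> c x y; rewrite !linearP|by []|].
have hs := tpow_word s.
by rewrite (assembleE F hs) (assembleE G (hF _ _ hs)) FK.
Qed.

Definition prim_aut : C1 :=
  mkgraut (assembleK prim_in primK) (assembleK primV_in primVK)
    (fun n x => assemble_in (@prim_in n)) (fun n x => assemble_in (@primV_in n)).

Lemma prim_autE n x : tpow n x -> prim_aut x = prim n x.
Proof. exact: assembleE. Qed.

Lemma prim_aut1 x : tpow 1 x -> prim_aut x = x.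
Proof.
move=> hx; rewrite (prim_autE hx) primS.
have -> : cut 0 x = tens (tone V) x by rewrite -{1}[x]tprod1l (cut_tprod tpow_tone hx).
by rewrite tmapE (z2_counital psi x).1 tmulE tprod1l.
Qed.

Lemma prim_autS n a b : tpow n a -> tpow 1 b ->
  prim_aut (tprod a b) = tmulby psi (prim_aut a) b.
Proof.
move=> na hb; have := tpow_tprod na hb; rewrite addn1 => /prim_autE ->.
by rewrite primS (cut_tprod na hb) tmapE (prim_autE na).
Qed.

Lemma prim_autM a b : prim_aut (tprod a b) = tmulby psi (prim_aut a) (prim_aut b).
Proof.
move: a; apply: talg_ext => [||s].
- by move=> c x y; rewrite tprod_linearl linearP.
- by move=> c x y; rewrite linearP tmulby_linearl.
move: b; apply: talg_ext => [||t].
- by move=> c x y; rewrite tprod_linearr linearP.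
- by move=> c x y; rewrite linearP tmulby_linearr.
elim/last_ind: t => [|t v IH].
  rewrite -/(tone V) tprod1r (prim_autE tpow_tone) /tmulby.
  by rewrite (z2_counital psi _).2 tmulE tprod1r.
have hv : tpow 1 (word [:: v]) := tpow_word [:: v].
have -> : word (rcons t v) = tprod (word t) (word [:: v]) by rewrite tprodE cats1.
have hst := tpow_tprod (tpow_word s) (tpow_word t).
rewrite tprodA (prim_autS hst hv) IH (prim_autS (tpow_word t) hv).
by rewrite ((cocycleP psi).1 (z2_cocycle psi)).
Qed.

Lemma primitive_exists : exists theta, is_primitive psi theta.
Proof.
exists prim_aut; split=> [x h0|x|u]; [exact: prim_autE h0|exact: prim_aut1|].
rewrite -[u](grautKV (sq prim_aut)); move: (graut_inv _ u) => {}u.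
rewrite [RHS]graut_compE grautK conj_tmul_autE.
move: u; apply: tensor_word_ext => [||s t]; try by move=> c x y; rewrite !linearP.
have st := tpow2_tens (tpow_word s) (tpow_word t).
apply: (@tmul_inj _ _ (size s) (size t)).
- exact: (c2_in psi (c2_in (sq prim_aut) st)).
- exact: conj_tmul_in.
by rewrite tmul_conj_tmul tmulE prim_autM sqE.
Qed.

Definition primitive : C1 := projT1 (cid primitive_exists).

Lemma primitiveP : is_primitive psi primitive.
Proof. by rewrite /primitive; case: cid. Qed.

Lemma primitive_sq u : tmul (psi (sq primitive u)) = primitive (tmul u).
Proof.
by have [_ _ ->] := primitiveP; rewrite graut_compE grautK conj_tmul_autE tmul_conj_tmul.
Qed.

Lemma primitive_tone : primitive (tone V) = tone V.
Proof. by have [+ _ _] := primitiveP; apply; exact: tpow_tone. Qed.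

Lemma primitive_unique theta : is_primitive psi theta -> theta =1 primitive.
Proof.
have step eta : is_primitive psi eta -> forall n a b, tpow n a -> tpow 1 b ->
    eta (tprod a b) = tmulby psi (eta a) b.
  move=> [_ e1 epsi] n a b na hb; rewrite -{2}(e1 _ hb) /tmulby epsi.
  by rewrite -sqE graut_compE grautK conj_tmul_autE tmul_conj_tmul tmulE.
move=> hth; apply: talg_ext => [||s]; try exact: linearP.
elim/last_ind: s => [|s v IH].
  by have [th0 _ _] := hth; rewrite primitive_tone (th0 _ tpow_tone).
have hv : tpow 1 (word [:: v]) := tpow_word [:: v].
have -> : word (rcons s v) = tprod (word s) (word [:: v]) by rewrite tprodE cats1.
by rewrite (step _ hth _ _ _ (tpow_word s) hv) IH (step _ primitiveP _ _ _ (tpow_word s) hv).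
Qed.

End Primitive.

(* psi (theta (x) theta) phi (theta (x) theta)^-1, theta the primitive of psi. *)
Definition star_map (psi phi : Z2) : C2 :=
  graut_comp psi (graut_comp (sq (primitive psi))
    (graut_comp phi (graut_inv (sq (primitive psi))))).

Lemma tmulby_star (psi phi : Z2) a b : tmulby (star_map psi phi) a b =
  primitive psi (tmulby phi (graut_inv (primitive psi) a) (graut_inv (primitive psi) b)).
Proof. by rewrite /tmulby !graut_compE primitive_sq sqVE. Qed.

Fact star_cocycle (psi phi : Z2) : cocycle (star_map psi phi).
Proof.
apply/cocycleP => a b c; rewrite !tmulby_star !grautK.
by rewrite ((cocycleP phi).1 (z2_cocycle phi)).
Qed.

Fact star_counital (psi phi : Z2) : counital (star_map psi phi).
Proof.
have thV1 : graut_inv (primitive psi) (tone V) = tone V.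
  by rewrite -{1}(primitive_tone psi) grautK.
move=> a; rewrite !graut_compE !sqVE thV1.
rewrite (z2_counital phi _).1 (z2_counital phi _).2 !sqE !grautKV primitive_tone.
exact: z2_counital.
Qed.

Definition star (psi phi : Z2) : Z2 :=
  MkZ2 (star_cocycle psi phi) (star_counital psi phi).

Fact inv_counital (psi : Z2) : counital (coboundary (graut_inv (primitive psi))).
Proof.
by apply: coboundary_counital; rewrite -{1}(primitive_tone psi) grautK.
Qed.

Definition z2inv (psi : Z2) : Z2 :=
  MkZ2 (coboundary_cocycle (graut_inv (primitive psi))) (inv_counital psi).

Lemma star_z2inv (psi : Z2) : star psi (z2inv psi) =1 id.
Proof.
move=> u; rewrite !graut_compE; have [_ _ ->] := primitiveP psi.
rewrite graut_compE grautK -[RHS](grautKV (sq (primitive psi))).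
set v := graut_inv _ u.
have -> : graut_inv (sq (graut_inv (primitive psi))) v = sq (primitive psi) v.
  move: v; apply: tensor_ext => [||x y]; try by move=> c x y; rewrite !linearP.
  rewrite sqVE sqE; congr tens; apply: (can_inj (grautK (graut_inv (primitive psi))));
    by rewrite grautKV grautK.
by rewrite !conj_tmul_autE (conj_tmulK (grautKV (primitive psi))).
Qed.

End Cochains.

Section QuantumSpaces.
Variable K : fieldType.

(* A quantum space: a unital associative algebra on the vector space qs_space
   (the zero algebra is allowed, unlike in algType) generated by the image of a
   finite-dimensional space qs_gen under the injection qs_incl. The product is a
   field on its own so that twisting changes it and leaves the space alone. *)
Record quantum_axioms (A : lmodType K) (V : vectType K) (incl : {linear V -> A})
    (one : A) (mul : A -> A -> A) : Prop := QuantumAxioms {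
  qa_incl_inj : injective incl;
  qa_mulDl : forall y, linear (mul^~ y);
  qa_mulDr : forall x, linear (mul x);
  qa_mulA : associative mul;
  qa_mul1l : left_id one mul;
  qa_mul1r : right_id one mul;
  qa_generated : forall B : set A, subspace B -> B one ->
    (forall x y, B x -> B y -> B (mul x y)) -> (forall v, B (incl v)) ->
    forall x, B x
}.

Record quantumSpace := QuantumSpace {
  qs_space : lmodType K;
  qs_gen : vectType K;
  qs_incl : {linear qs_gen -> qs_space};
  qs_one : qs_space;
  qs_mul : qs_space -> qs_space -> qs_space;
  qs_axioms : quantum_axioms qs_incl qs_one qs_mul
}.

Section Epimorphism.
Variable A : quantumSpace.
Notation mul := (@qs_mul A).
Notation one := (@qs_one A).
Notation incl := (@qs_incl A).
Let ax := qs_axioms A.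

(* The canonical epimorphism Pi, see epiM, epi_tone, epi_word1 and epi_surj. *)
Fact epi_multilinear :
  multilinear (fun s : seq (qs_gen A) => foldr (fun v x => mul (incl v) x) one s).
Proof.
move=> c v w s t; elim: s => [|u s IH] /=; first by rewrite linearP (qa_mulDl ax).
by rewrite IH (qa_mulDr ax).
Qed.

Definition epi : {linear talg (qs_gen A) -> qs_space A} := wlift epi_multilinear.

Definition mulmap : {linear tensor (qs_space A) (qs_space A) -> qs_space A} :=
  tlift (qa_mulDl ax) (qa_mulDr ax).

Lemma mulmapE x y : mulmap (tens x y) = mul x y.
Proof. exact: tliftE. Qed.

Lemma epi_word1 v : epi (word [:: v]) = incl v.
Proof. by rewrite wliftE /= (qa_mul1r ax). Qed.

Lemma epi_tone : epi (tone _) = one.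
Proof. exact: wliftE. Qed.

Lemma epiM x y : epi (tprod x y) = mul (epi x) (epi y).
Proof.
move: x; apply: talg_ext => [||s].
- by move=> c x x'; rewrite tprod_linearl linearP.
- by move=> c x x'; rewrite linearP (qa_mulDl ax).
move: y; apply: talg_ext => [||t].
- by move=> c x x'; rewrite tprod_linearr linearP.
- by move=> c x x'; rewrite linearP (qa_mulDr ax).
rewrite tprodE !wliftE; elim: s => [|v s IH] /=; first by rewrite (qa_mul1l ax).
by rewrite IH (qa_mulA ax).
Qed.

Lemma epi_unique (f : {linear talg (qs_gen A) -> qs_space A}) :
  f (tone _) = one -> (forall x y, f (tprod x y) = mul (f x) (f y)) ->
  (forall v, f (word [:: v]) = incl v) -> f =1 epi.
Proof.
move=> f1 fM fi; apply: talg_ext => [||s]; try exact: linearP.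
elim: s => [|v s IH]; first by rewrite f1 epi_tone.
by rewrite -cat1s -tprodE fM fi IH epiM epi_word1.
Qed.

Lemma epi_surj x : exists t, epi t = x.
Proof.
apply: (qa_generated ax (B := [set x | exists t, epi t = x])).
- split=> [|c _ _ [s <-] [t <-]]; first by exists 0; rewrite linear0.
  by exists (c *: s + t); rewrite linearP.
- by exists (tone _); rewrite epi_tone.
- by move=> _ _ [s <-] [t <-]; exists (tprod s t); rewrite epiM.
by move=> v; exists (word [:: v]); rewrite epi_word1.
Qed.

Lemma epi2_surj y : exists u, tmap epi epi u = y.
Proof.
move: y; apply: (@tensor_ind _ _ _ [set y | exists u, tmap epi epi u = y]).
  split=> [|c _ _ [s <-] [t <-]]; first by exists 0; rewrite linear0.
  by exists (c *: s + t); rewrite linearP.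
move=> x y; have [s <-] := epi_surj x; have [t <-] := epi_surj y.
by exists (tens s t); rewrite tmapE.
Qed.

Definition ker_epi2 : set (tensor (talg (qs_gen A)) (talg (qs_gen A))) :=
  [set u | tmap epi epi u = 0].

Definition admissible (psi : C2 (qs_gen A)) := psi @` ker_epi2 = ker_epi2.

End Epimorphism.
Arguments admissible A psi : clear implicits.

Section Twist.
Variables (A : quantumSpace) (psi : Z2 (qs_gen A)) (hpsi : admissible A psi).
Notation mul := (@qs_mul A).
Notation one := (@qs_one A).
Notation incl := (@qs_incl A).
Notation epi := (epi A).
Let ax := qs_axioms A.

Fact descent_ex y : exists z, forall u, tmap epi epi u = y -> z = tmap epi epi (psi u).
Proof.
have [u <-] := epi2_surj y; exists (tmap epi epi (psi u)) => u' huu'.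
apply/eqP; rewrite -subr_eq0 -!linearB; apply/eqP.
have : (psi @` @ker_epi2 A) (psi (u - u')) by exists (u - u') => //=; rewrite /ker_epi2 /= linearB huu' subrr.
by rewrite hpsi.
Qed.

Definition descentf y := projT1 (cid (descent_ex y)).

Fact descentfE u : descentf (tmap epi epi u) = tmap epi epi (psi u).
Proof. by rewrite /descentf; case: cid => z /= /(_ u erefl). Qed.

Fact descentf_linear : linear descentf.
Proof.
move=> c x y; have [u <-] := epi2_surj x; have [v <-] := epi2_surj y.
by rewrite -linearP !descentfE !linearP.
Qed.

(* The map Psi induced by psi on the tensor square of the algebra. *)
Definition descent : {linear tensor (qs_space A) (qs_space A) ->
    tensor (qs_space A) (qs_space A)} := mklin descentf_linear.

Lemma descentE u : descent (tmap epi epi u) = tmap epi epi (psi u).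
Proof. by rewrite mklinE descentfE. Qed.

Definition twist_mul x y := mulmap A (descent (tens x y)).

Lemma mulmap_epi2 u : mulmap A (tmap epi epi u) = epi (tmul u).
Proof.
move: u; apply: tensor_ext => [||x y]; try by move=> c x y; rewrite !linearP.
by rewrite tmapE mulmapE tmulE epiM.
Qed.

Lemma twist_mul_epi x y : twist_mul (epi x) (epi y) = epi (tmulby psi x y).
Proof. by rewrite /twist_mul -tmapE descentE mulmap_epi2. Qed.

Fact twist_axioms : quantum_axioms incl one twist_mul.
Proof.
split.
- exact: qa_incl_inj ax.
- by move=> y c x x'; rewrite /twist_mul tens_linearl !linearP.
- by move=> x c y y'; rewrite /twist_mul tens_linearr !linearP.
- move=> x y z; have [a <-] := epi_surj x; have [b <-] := epi_surj y.
  have [c <-] := epi_surj z.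
  by rewrite !twist_mul_epi ((cocycleP psi).1 (z2_cocycle psi)).
- move=> x; have [a <-] := epi_surj x; rewrite -epi_tone twist_mul_epi /tmulby.
  by rewrite (z2_counital psi a).1 tmulE tprod1l.
- move=> x; have [a <-] := epi_surj x; rewrite -epi_tone twist_mul_epi /tmulby.
  by rewrite (z2_counital psi a).2 tmulE tprod1r.
move=> B hB B1 BM Bi x; have [a <-] := epi_surj x.
have Be : subspace [set a | B (epi a)] := subspace_preim (linearP epi) hB.
move: a; apply: talg_ind => // s.
have Bn n : forall a, tpow n a -> B (epi a).
  elim: n => [|n IH].
    by apply: (tpow_ind Be) => t /size0nil ->; rewrite /= epi_tone.
  move=> a; rewrite -addn1 => /cut_tpow2 /(c2_in (graut_inv psi)) hu.
  rewrite -[a](cutK n) -[cut n a](grautKV psi); move: (graut_inv _ _) hu.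
  apply: (@tpow2_ind _ _ _ _ [set u | B (epi (tmul (psi u)))]).
    apply: (subspace_preim (f := fun u => epi (tmul (psi u)))) hB.
    by move=> c u v; rewrite !linearP.
  move=> b v nb hv /=; rewrite -[tmul _]/(tmulby psi b v) -twist_mul_epi.
  apply: BM; first exact: IH.
  move: v hv; apply: (tpow_ind Be) => -[|v [|//]] //= _.
  by rewrite epi_word1; apply: Bi.
exact: Bn (tpow_word s).
Qed.

Definition twist : quantumSpace :=
  @QuantumSpace (qs_space A) (qs_gen A) incl one twist_mul twist_axioms.

End Twist.
End QuantumSpaces.

Arguments epi {K} A.
Arguments ker_epi2 {K} A.
Arguments admissible {K} A psi.
Arguments twist {K} A {psi} hpsi.

(* Main.v *)
Require Import Defs.
From mathcomp Require Import all_boot all_order all_algebra reals.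
From mathcomp Require Import boolp classical_sets.

(** The idea is to transport everything along the primitive [theta] of [psi].

    Read as a cocycle, [psi] deforms the concatenation product of the tensor
    algebra into the associative product [tmulby psi], and
    [psi = coboundary theta] says that [theta] is an isomorphism from the
    tensor algebra to this deformed algebra. Since [epi A] is an algebra map
    from the deformed algebra to the twisting, [epi A \o theta] is an algebra
    map from the tensor algebra to the twisting; as [theta] is the identity in
    degree one, it is the canonical epimorphism of the twisting ([epi_twist]).

    Two consequences carry the proof. First, writing N for the kernel of the
    tensor square of [epi A], the corresponding kernel for the twisting is the
    preimage of N under [theta (x) theta]. As [star psi phi] is [psi] composed
    with the conjugate of [phi] by [theta (x) theta], and [psi] preserves N,
    preserving the new kernel by [phi] amounts to preserving N by
    [star psi phi] ([admissible_twist]). Second, the product of the iterated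
    twisting is, at the images under [epi A] of [a] and [b], the image of the
    conjugate by [theta] of the [phi]-deformed product, which is exactly
    [tmulby (star psi phi) a b] ([twist_twist_mul_epi]).

    The statements on the inverse are the case [phi = z2inv psi], in which
    [star psi phi] is the identity. *)

Set Implicit Arguments.
Unset Strict Implicit.
Unset Printing Implicit Defensive.

Import GRing.Theory.

Section TwistOfTwist.
Variable K : fieldType.
Implicit Type A : quantumSpace K.

Lemma eq_quantumSpace A mul (ax : quantum_axioms (@qs_incl K A) (@qs_one K A) mul) :
  mul =2 @qs_mul K A -> QuantumSpace ax = A.
Proof.
case: A mul ax => S V incl one m axm mul ax /= mulE.
have {}mulE : mul = m by apply/funext => x; apply/funext => y; apply: mulE.
by subst mul; congr QuantumSpace; apply: Prop_irrelevance.
Qed.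

(** Since [psi] is invertible, its mapping the kernel onto itself is a
    pointwise equivalence, which composes better than an equality of images. *)
Lemma admissibleP A (psi : C2 (qs_gen A)) :
  admissible A psi <-> forall u, ker_epi2 A (psi u) <-> ker_epi2 A u.
Proof.
split=> [hpsi u|hpsi].
  split=> hu; last by rewrite -hpsi; exists u.
  by move: hu; rewrite -{1}hpsi => -[v hv /(can_inj (grautK psi)) <-].
apply/seteqP; split=> [_ [u hu <-]|u hu]; first exact/hpsi.
by exists (graut_inv psi u); [apply/hpsi; rewrite grautKV|rewrite grautKV].
Qed.

Section Twisting.
Variables (A : quantumSpace K) (psi : Z2 (qs_gen A)) (hpsi : admissible A psi).
Local Notation theta := (primitive psi).

(** The multiplicative form of the equation [psi = coboundary theta]. *)
Lemma primitive_tprod x y :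
  theta (tprod x y) = tmulby psi (theta x) (theta y).
Proof. by rewrite /tmulby -sqE primitive_sq tmulE. Qed.

(** The right-hand side is an algebra map to the twisting and restricts to
    the inclusion in degree one, where [theta] is the identity: the uniqueness of
    the canonical epimorphism applies. *)
Lemma epi_twist : epi (twist A hpsi) =1 epi A \o theta.
Proof.
move=> x; symmetry; move: x.
apply: (@epi_unique K (twist A hpsi) (epi A \o theta : {linear _ -> _})).
- by rewrite /= primitive_tone epi_tone.
- by move=> x y /=; rewrite primitive_tprod -twist_mul_epi.
- move=> v /=; have [_ theta1 _] := primitiveP psi.
  by rewrite (theta1 _ (tpow_word [:: v])) epi_word1.
Qed.

Lemma ker_epi2_twist u : ker_epi2 (twist A hpsi) u <-> ker_epi2 A (sq theta u).
Proof.
rewrite /ker_epi2 /=; suff -> : tmap (epi (twist A hpsi)) (epi (twist A hpsi)) u =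
  tmap (epi A) (epi A) (sq theta u) by [].
move: u; apply: tensor_ext => [||x y]; try by move=> c x y; rewrite !linearP.
by rewrite sqE !tmapE !epi_twist.
Qed.

(** The kernel of the twisting being the preimage of that of [A] under
    [theta (x) theta], this conjugates the condition on [phi]; the leftmost
    factor [psi] of the star product is absorbed by its own admissibility. *)
Lemma admissible_twist (phi : Z2 (qs_gen A)) :
  admissible (twist A hpsi) phi <-> admissible A (star psi phi).
Proof.
have starE u : ker_epi2 A (star psi phi (sq theta u)) <->
    ker_epi2 (twist A hpsi) (phi u).
  rewrite !graut_compE grautK.
  apply: iff_trans ((admissibleP psi).1 hpsi _) _.
  exact: iff_sym (ker_epi2_twist _).
split=> /admissibleP h; apply/admissibleP => u.
  rewrite -[u](grautKV (sq theta)); apply: iff_trans (starE _) _.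
  exact: iff_trans (h _) (ker_epi2_twist _).
apply: iff_trans (iff_sym (starE _)) _.
exact: iff_trans (h _) (iff_sym (ker_epi2_twist _)).
Qed.

Lemma twist_twist_mul_epi (phi : Z2 (qs_gen A))
    (hphi : admissible (twist A hpsi) phi) a b :
  twist_mul hphi (epi A a) (epi A b) = epi A (tmulby (star psi phi) a b).
Proof.
rewrite tmulby_star -[a in LHS](grautKV theta) -[b in LHS](grautKV theta).
have epiE x : epi A (theta x) = epi (twist A hpsi) x by rewrite epi_twist.
by rewrite !epiE (twist_mul_epi hphi).
Qed.

End Twisting.
End TwistOfTwist.

Theorem proposition14 (R : realType) (k : ground_field)
    (A : quantumSpace (scalars R k)) (psi phi : Z2 (qs_gen A))
    (hpsi : admissible A psi) (hphi : admissible (twist A hpsi) phi) :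
  (exists h : admissible A (star psi phi),
     twist (twist A hpsi) hphi = twist A h) /\
  (exists h : admissible (twist A hpsi) (z2inv psi),
     twist (twist A hpsi) h = A).
Proof.
split.
  have h := (admissible_twist hpsi phi).1 hphi; exists h.
  apply: (@eq_quantumSpace _ (twist A h)) => x y.
  have [a <-] := @epi_surj _ A x; have [b <-] := @epi_surj _ A y.
  exact: etrans (twist_twist_mul_epi hphi a b) (esym (twist_mul_epi h a b)).
have h : admissible (twist A hpsi) (z2inv psi).
  by apply/admissible_twist/admissibleP => u; rewrite star_z2inv.
exists h; apply: (@eq_quantumSpace _ A) => x y.
have [a <-] := @epi_surj _ A x; have [b <-] := @epi_surj _ A y.
apply: etrans (twist_twist_mul_epi h a b) _.
by rewrite /tmulby star_z2inv tmulE epiM.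
Qed.
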